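(* Let $k>0$ be an integer. Then there exist real numbers $a=a(k)$ and $b=b(k)$, depending only on $k$, such that for every positive integer $n$, all partitions $\lambda,\mu\in H(k,0;n)$ and every partition $\rho\vdash n$, the Kronecker multiplicity satisfies $\kappa(\lambda,\mu,\rho)\le a\cdot n^b$.
   Context: The base field has characteristic zero. For a partition $\lambda\vdash n$, $\chi^\lambda$ denotes the corresponding irreducible character of the symmetric group $S_n$. For two characters $\varphi,\psi$ of $S_n$ (same $n$), the Kronecker (inner tensor) product is the character $(\varphi\otimes\psi)(\sigma)=\varphi(\sigma)\psi(\sigma)$, $\sigma\in S_n$. For $\lambda,\mu\vdash n$, the Kronecker multiplicities $\kappa(\lambda,\mu,\rho)$ are the non-negative integers defined by $\chi^\lambda\otimes\chi^\mu=\sum_{\rho\vdash n}\kappa(\lambda,\mu,\rho)\chi^\rho$. The $k$-strip is $H(k,0;n)=\{\lambda=(\lambda_1,\lambda_2,\ldots)\vdash n\mid \lambda_{k+1}=0\}$, i.e. the partitions of $n$ with at most $k$ nonzero parts. *)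

(* Defs.v *)
From HB Require Import structures.
From mathcomp Require Import all_boot all_order all_algebra all_fingroup all_character.

Set Implicit Arguments.
Unset Strict Implicit.
Unset Printing Implicit Defensive.

Import GroupScope GRing.Theory.
Local Open Scope ring_scope.

(* A partition of n is encoded as the non-increasing sequence of its parts,
   padded with zeros to length n (no partition of n has more than n parts, nor
   a part exceeding n).  This makes [intpart n] a finType. *)
Definition is_intpart (n : nat) (t : n.-tuple 'I_n.+1) : bool :=
  let s := [seq val i | i <- t] in sorted geq s && (sumn s == n).

Definition intpart (n : nat) := {t : n.-tuple 'I_n.+1 | is_intpart t}.

Definition parts (n : nat) (lam : intpart n) : seq nat :=
  [seq nat_of_ord i | i <- val lam].

(* Parts are indexed from 0, so lambda_{k+1} is [nth 0 (parts lam) k]. *)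
Definition in_strip (k n : nat) (lam : intpart n) : bool :=
  nth 0%N (parts lam) k == 0%N.

(* The tableau of shape lam is the one filled with 0, 1, ..., n-1 in reading
   order: [reshape_index] and [reshape_offset] give the row and the column
   of an entry. *)
Definition row_stab (n : nat) (lam : intpart n) : {set 'S_n} :=
  [set s : 'S_n | [forall i : 'I_n,
     reshape_index (parts lam) (s i) == reshape_index (parts lam) i]].

Definition col_stab (n : nat) (lam : intpart n) : {set 'S_n} :=
  [set s : 'S_n | [forall i : 'I_n,
     reshape_offset (parts lam) (s i) == reshape_offset (parts lam) i]].

(* The Young symmetrizer, as a vector of the regular module F[S_n], whose basis
   vector attached to s is [delta_mx 0 (gring_index _ s)]. *)
Definition young_symmetrizer (F : fieldType) (n : nat) (lam : intpart n) :
    'rV[F]_#|[set: 'S_n]| :=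
  \sum_(p in row_stab lam) \sum_(q in col_stab lam)
    (-1) ^+ q *: delta_mx 0 (gring_index [set: 'S_n] (p * q)%g).

(* MathComp representations act on the right, so the irreducible module
   attached to lam is the right ideal generated by the Young symmetrizer. *)
Definition specht_repr (F : fieldType) (n : nat) (lam : intpart n) :=
  submod_repr (cyclic_mx_module (regular_repr F [set: 'S_n])
                                (young_symmetrizer F lam)).

Definition chi (F : fieldType) (n : nat) (lam : intpart n) (s : 'S_n) : F :=
  \tr (specht_repr F lam s).

Definition kronecker_multiplicities (F : fieldType) (n : nat)
    (kappa : intpart n -> intpart n -> intpart n -> nat) : Prop :=
  forall (lam mu : intpart n) (s : 'S_n),
    chi F lam s * chi F mu s =
    \sum_(rho : intpart n) (kappa lam mu rho)%:R * chi F rho s.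

(* Main.v *)
Require Import Defs.
From mathcomp Require Import all_boot all_order all_algebra all_fingroup.
From mathcomp Require Import all_character.
From mathcomp Require Import reals exp.

Set Implicit Arguments.
Unset Strict Implicit.
Unset Printing Implicit Defensive.

Import GroupScope Order.TTheory GRing.Theory Num.Theory.
Local Open Scope ring_scope.

(* Write <f, g> for the inner product of characters.  It takes values in the
   natural numbers and <chi^rho, chi^rho> > 0, so expanding chi^lam * chi^mu gives
   kappa(lam, mu, rho)^2 <= <chi^lam chi^mu, chi^lam chi^mu>.  When lam has at most
   k parts, the Specht module of lam embeds in the permutation module on words of
   length n over k letters (send g to the word recording the row of each
   entry), whose character P therefore exceeds chi^lam by a character.  Hence the
   right-hand side is at most <P^2, P^2>, which by Burnside's lemma is the number of
   orbits of S_n on words over k^4 letters.  Such an orbit is determined by the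
   number of occurrences of each letter, so there are at most (n+1)^(k^4) of them. *)

(** * Characters as traces, and their inner product *)

Section InnerProduct.

Variables (F : fieldType) (gT : finGroupType) (G : {group gT}).
Hypothesis F0 : [pchar F] =i pred0.

Let cardG_neq0 : #|G|%:R != 0 :> F.
Proof. by have /pcharf0P-> := F0; rewrite -lt0n cardG_gt0. Qed.

(** Factor [E] through its image: idempotence makes [row_base E *m col_base E] the identity of size
    [\rank E], and the trace is cyclic. *)
Lemma mxtrace_idem n (E : 'M[F]_n) : E *m E = E -> \tr E = (\rank E)%:R.
Proof.
move=> EE; suff baseK: row_base E *m col_base E = 1%:M.
  by rewrite -{1}[E]mulmx_base mxtrace_mulC baseK mxtrace1.
apply: (row_full_inj (col_base_full E)); apply: (row_free_inj (row_base_free E)).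
by rewrite /= mulmx1 mulmxA mulmx_base -mulmxA mulmx_base EE.
Qed.

(** The coefficient of [delta_mx i j] in [A *m delta_mx i j *m B] is [A i i * B j j]. *)
Lemma mxtrace_lin_mul m n (A : 'M[F]_m) (B : 'M[F]_n) :
  \tr (lin_mx (mulmxr B \o mulmx A)) = \tr A * \tr B.
Proof.
rewrite /mxtrace big_distrlr pair_bigA /= (reindex _ (curry_mxvec_bij m n)) /=.
apply: eq_bigr => -[i j] _ /=.
have diagE p (M : 'M[F]_p) k : M k k = (delta_mx (0 : 'I_1) k *m M) 0 k.
  by rewrite -rowE mxE.
rewrite diagE.
rewrite -mxvec_delta mul_rV_lin /= mxvecK mxvecE -mulmxA.
rewrite mxE (bigD1 i) //= big1 ?addr0 => [|i' /negPf ni'].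
  rewrite mxE (bigD1 j) //= big1 ?addr0 => [|j' /negPf nj'].
    by rewrite mxE !eqxx mul1r.
  by rewrite mxE nj' andbF mul0r.
by rewrite mxE big1 ?mulr0 // => j' _; rewrite mxE ni' mul0r.
Qed.

(** Inversion replaces complex conjugation, so the pairing makes sense over [F]. *)
Definition cdot (f g : gT -> F) : F :=
  #|G|%:R^-1 * \sum_(s in G) f s^-1%g * g s.

(** Degree 0 is allowed, so a zero complement still counts as a character. *)
Definition is_char (f : gT -> F) :=
  exists n (rG : mx_representation F G n), {in G, forall s, f s = \tr (rG s)}.

(** The action of [G] on Hom([rG1], [rG2]), whose fixed vectors are the intertwining matrices. *)
Definition hom_mx m n (rG1 : mx_representation F G m)
    (rG2 : mx_representation F G n) (s : gT) :=
  lin_mx (mulmxr (rG2 s) \o mulmx (rG1 s^-1%g)).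

(** The Reynolds operator, projecting onto the intertwining matrices. *)
Definition hom_avg m n (rG1 : mx_representation F G m)
    (rG2 : mx_representation F G n) :=
  #|G|%:R^-1 *: \sum_(s in G) hom_mx rG1 rG2 s.

Lemma hom_mxM m n (rG1 : mx_representation F G m)
    (rG2 : mx_representation F G n) :
  {in G &, {morph hom_mx rG1 rG2 : s t / (s * t)%g >-> s *m t}}.
Proof.
move=> s t Gs Gt; apply/row_matrixP => i; rewrite !rowE mulmxA !mul_rV_lin /= mxvecK.
by rewrite invMg !repr_mxM ?groupV // !mulmxA.
Qed.

Lemma hom_avg_idem m n (rG1 : mx_representation F G m)
    (rG2 : mx_representation F G n) :
  hom_avg rG1 rG2 *m hom_avg rG1 rG2 = hom_avg rG1 rG2.
Proof.
have absorb s : s \in G -> hom_mx rG1 rG2 s *m hom_avg rG1 rG2 = hom_avg rG1 rG2.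
  move=> Gs; rewrite /hom_avg -scalemxAr mulmx_sumr; congr (_ *: _).
  rewrite [RHS](reindex_inj (mulgI s)) /=.
  apply: eq_big => [t | t Gt]; first by rewrite groupMl.
  by rewrite hom_mxM.
rewrite {1}/hom_avg -scalemxAl mulmx_suml (eq_bigr _ absorb) sumr_const.
by rewrite -scaler_nat scalerA mulVf ?scale1r.
Qed.

(** The trace of the averaging projection is both the average of the traces and its rank, the
    dimension of the space of intertwining matrices. *)
Lemma cdot_rank m n (rG1 : mx_representation F G m)
    (rG2 : mx_representation F G n) f g :
    {in G, forall s, f s = \tr (rG1 s)} -> {in G, forall s, g s = \tr (rG2 s)} ->
  cdot f g = (\rank (hom_avg rG1 rG2))%:R.
Proof.
move=> def_f def_g; rewrite -mxtrace_idem ?hom_avg_idem //.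
rewrite /hom_avg mxtraceZ raddf_sum; congr (_ * _); apply: eq_bigr => s Gs.
by rewrite def_f ?groupV // def_g // -mxtrace_lin_mul.
Qed.

Lemma cdot_nat f g : is_char f -> is_char g -> exists m : nat, cdot f g = m%:R.
Proof.
move=> [m [rf def_f]] [n [rg def_g]]; exists (\rank (hom_avg rf rg)).
exact: cdot_rank.
Qed.

(* The identity is a nonzero fixed vector of [Hom(V, V)]. *)
Lemma cdot_norm_gt0 n (rG : mx_representation F G n) f :
    (0 < n)%N -> {in G, forall s, f s = \tr (rG s)} ->
  exists2 m : nat, cdot f f = m%:R & (0 < m)%N.
Proof.
move=> n_gt0 def_f; exists (\rank (hom_avg rG rG)); first exact: cdot_rank.
rewrite lt0n mxrank_eq0; apply: contraTneq n_gt0 => E0.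
have: mxvec 1%:M *m hom_avg rG rG = mxvec 1%:M.
  rewrite -scalemxAr mulmx_sumr (eq_bigr (fun=> mxvec 1%:M)).
    by rewrite sumr_const -scaler_nat scalerA mulVf ?scale1r.
  move=> s Gs; rewrite mul_rV_lin /= mxvecK mulmx1.
  by rewrite -repr_mxM ?groupV // mulVg repr_mx1.
by rewrite E0 mulmx0 => /esym/eqP; rewrite mxvec_eq0 -mxrank_eq0 mxrank1 => /eqP->.
Qed.

Lemma is_charM f g : is_char f -> is_char g -> is_char (fun s => f s * g s).
Proof.
move=> [m [rf def_f]] [n [rg def_g]]; exists (m * n)%N, (prod_repr rf rg) => s Gs.
by rewrite mxtrace_prod def_f ?def_g.
Qed.

Lemma is_charD f g : is_char f -> is_char g -> is_char (fun s => f s + g s).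
Proof.
move=> [m [rf def_f]] [n [rg def_g]].
exists (m + n)%N,
  (MxRepresentation (add_mx_repr (Representation rf) (Representation rg))).
by move=> s Gs; rewrite /= mxtrace_block def_f ?def_g.
Qed.

Lemma cdotDl f g h : cdot (fun s => f s + g s) h = cdot f h + cdot g h.
Proof.
rewrite /cdot -mulrDr -big_split; congr (_ * _).
by apply: eq_bigr => s _; rewrite mulrDl.
Qed.

Lemma cdotDr f g h : cdot h (fun s => f s + g s) = cdot h f + cdot h g.
Proof.
rewrite /cdot -mulrDr -big_split; congr (_ * _).
by apply: eq_bigr => s _; rewrite mulrDr.
Qed.

Lemma cdot_suml I (r : seq I) (f : I -> gT -> F) (a : I -> F) g :
  cdot (fun s => \sum_(i <- r) a i * f i s) g = \sum_(i <- r) a i * cdot (f i) g.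
Proof.
rewrite /cdot; under [RHS]eq_bigr => i _ do rewrite mulrCA mulr_sumr.
rewrite -mulr_sumr exchange_big /=; congr (_ * _); apply: eq_bigr => s _.
by rewrite mulr_suml; apply: eq_bigr => i _; rewrite mulrA.
Qed.

Lemma cdot_sumr I (r : seq I) (f : I -> gT -> F) (a : I -> F) g :
  cdot g (fun s => \sum_(i <- r) a i * f i s) = \sum_(i <- r) a i * cdot g (f i).
Proof.
rewrite /cdot; under [RHS]eq_bigr => i _ do rewrite mulrCA mulr_sumr.
rewrite -mulr_sumr exchange_big /=; congr (_ * _); apply: eq_bigr => s _.
by rewrite mulr_sumr; apply: eq_bigr => i _; rewrite mulrCA.
Qed.

Lemma eq_cdot f f' g g' :
  {in G, f =1 f'} -> {in G, g =1 g'} -> cdot f g = cdot f' g'.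
Proof.
move=> eqf eqg; congr (_ * _); apply: eq_bigr => s Gs.
by rewrite eqf ?groupV ?eqg.
Qed.

(** The row space of [B] is a submodule isomorphic to [rG1], and [d] is the character of the
    quotient. *)
Lemma mxtrace_intertwine m n (rG1 : mx_representation F G m)
    (rG2 : mx_representation F G n) (B : 'M_(m, n)) :
    row_free B -> {in G, forall s, rG1 s *m B = B *m rG2 s} ->
  exists2 d, is_char d & {in G, forall s, \tr (rG2 s) = \tr (rG1 s) + d s}.
Proof.
move=> freeB homB; have modB : mxmodule rG2 <<B>>%MS.
  apply/mxmoduleP => s Gs.
  by rewrite genmxE (eqmxMr _ (genmxE B)) -homB ?submxMl.
exists (fun s => \tr (factmod_repr modB s)); first by eexists _, _.
move=> s Gs; rewrite -(mxtrace_sub_fact_mod modB); congr (_ + _).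
symmetry; apply: mxtrace_rsim Gs.
have sBB: (B <= <<B>>)%MS by rewrite genmxE.
exists (in_submod <<B>>%MS B) => [||x Gx].
- by rewrite genmxE; apply/esym/eqP.
- by rewrite /row_free mxrank_in_submod.
have <- := in_submodJ modB x sBB; rewrite -homB //.
by rewrite [in LHS]in_submodE [in RHS]in_submodE mulmxA.
Qed.

End InnerProduct.

(** [F] carries no order: inner products are compared in [nat], where this injectivity transfers the
    equalities. *)
Lemma pchar0_natr_inj (F : fieldType) :
  [pchar F] =i pred0 -> injective (fun m : nat => m%:R : F).
Proof.
move=> /pcharf0P F0 m n /= eqmn.
wlog le_mn : m n eqmn / (m <= n)%N.
  by case: (leqP m n) => [le_mn | /ltnW le_nm] W; [|symmetry]; apply: W.
have /eqP : (n - m)%:R = 0 :> F by rewrite natrB // eqmn subrr.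
by rewrite F0 subn_eq0 => le_nm; apply/eqP; rewrite eqn_leq le_mn.
Qed.

(** * Permutation representations *)

Section ActionRepr.

Variables (F : fieldType) (gT : finGroupType) (G : {group gT}) (W : finType).
Variable to : {action gT &-> W}.

Definition action_mx (s : gT) : 'M[F]_#|W| :=
  \matrix_i delta_mx 0 (enum_rank (to (enum_val i) s)).

Lemma action_mx_repr : mx_repr G action_mx.
Proof.
split=> [|s t _ _]; apply/row_matrixP => i.
  by rewrite rowK act1 enum_valK row1.
by rewrite row_mul !rowK -rowE rowK enum_rankK actM.
Qed.
Definition action_repr := MxRepresentation action_mx_repr.

(** The diagonal entry at a point is 1 if [s] fixes it and 0 otherwise. *)
Lemma mxtrace_action s : \tr (action_repr s) = #|'Fix_to[s]|%:R.
Proof.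
rewrite -sum1_card natr_sum [RHS]big_mkcond /= /mxtrace.
rewrite (reindex (@enum_rank W)); last by apply: onW_bij; apply: enum_rank_bij.
apply: eq_bigr => w _; rewrite !mxE eqxx /= enum_rankK (inj_eq enum_rank_inj).
by rewrite eq_sym -(sameP afix1P eqP); case: (w \in _).
Qed.

End ActionRepr.

(** * Words under permutation of positions *)

Section Words.

Variables (n : nat) (T : finType).
Implicit Types (w : {ffun 'I_n -> T}) (s : 'S_n).

Definition word_act w s : {ffun 'I_n -> T} := [ffun i => w (s^-1%g i)].

Lemma word_act1 : word_act^~ 1%g =1 id.
Proof. by move=> w; apply/ffunP => i; rewrite ffunE invg1 perm1. Qed.

Lemma word_actM w s t : word_act w (s * t)%g = word_act (word_act w s) t.
Proof. by apply/ffunP => i; rewrite !ffunE invMg permM. Qed.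

Definition word_action := TotalAction word_act1 word_actM.

(** Counts never exceed [n], so [inord] leaves them unchanged. *)
Definition content w : {ffun T -> 'I_n.+1} :=
  [ffun x => inord (count_mem x (mktuple w))].

Lemma content_orbit w1 w2 : content w1 = content w2 ->
  orbit word_action [set: 'S_n] w1 = orbit word_action [set: 'S_n] w2.
Proof.
move=> eq12; apply/orbit_eqP.
have /tuple_permP[p def1] : perm_eq (mktuple w1) (mktuple w2).
  apply/allP => x _ /=; have /ffunP/(_ x)/(congr1 (@nat_of_ord _)) := eq12.
  have le_n w : (count_mem x (mktuple w) < n.+1)%N.
    by rewrite ltnS (leq_trans (count_size _ _)) ?size_tuple.
  by rewrite !ffunE !inordK ?le_n // => ->.
apply/orbitP; exists p^-1%g; rewrite ?inE //.
apply/ffunP => i; rewrite ffunE invgK.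
have /(congr1 (fun t => tnth t i)) := val_inj def1.
by rewrite !tnth_mktuple.
Qed.

Lemma card_word_orbits :
  (#|orbit word_action [set: 'S_n] @: [set: {ffun 'I_n -> T}]| <= n.+1 ^ #|T|)%N.
Proof.
(* Contents index the orbits; [set0] is a filler for functions that are the content of no word. *)
pose orb (c : {ffun T -> 'I_n.+1}) :=
  if [pick w | content w == c] is Some w then orbit word_action [set: 'S_n] w
  else set0.
have -> : (n.+1 ^ #|T| = #|[set: {ffun T -> 'I_n.+1}]|)%N.
  by rewrite cardsT card_ffun card_ord.
apply: leq_trans (leq_imset_card orb _); apply: subset_leq_card.
apply/subsetP => _ /imsetP[w _ ->]; apply/imsetP; exists (content w) => //.
rewrite /orb; case: pickP => [w' /eqP/content_orbit-> // | /(_ w)].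
by rewrite eqxx.
Qed.

End Words.

(** * Fixed words and Burnside's lemma *)

Definition nfix n (T : finType) (s : 'S_n) := #|afix (word_action n T) [set s]|.

Lemma nfixV n T (s : 'S_n) : nfix T s^-1%g = nfix T s.
Proof.
rewrite /nfix; apply: eq_card => w; apply/afix1P/afix1P => fw.
  by rewrite -[in LHS]fw actKV.
by rewrite -[in LHS]fw actK.
Qed.

(** A pair of fixed words is the same as a fixed word of pairs. *)
Lemma nfixM n T U (s : 'S_n) : (nfix T s * nfix U s)%N = nfix (T * U)%type s.
Proof.
rewrite /nfix -cardsX.
pose zipw (u : {ffun 'I_n -> T} * {ffun 'I_n -> U}) := [ffun i => (u.1 i, u.2 i)].
have zipI : injective zipw.
  move=> [a b] [c d] /ffunP eqz; congr (_, _); apply/ffunP => i.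
    by have := eqz i; rewrite !ffunE => -[].
  by have := eqz i; rewrite !ffunE => -[].
rewrite -(card_imset _ zipI); apply: eq_card => w.
apply/imsetP/afix1P => [[[a b] /setXP[/afix1P /= fa /afix1P /= fb] ->] | /ffunP fw].
  apply/ffunP => i; have /ffunP/(_ i) := fa; have /ffunP/(_ i) := fb.
  by rewrite /= !ffunE /= => -> ->.
exists ([ffun i => (w i).1], [ffun i => (w i).2]).
  apply/setXP; split; apply/afix1P/ffunP => i; have := fw i;
  by rewrite /= !ffunE => ->.
by apply/ffunP => i; rewrite !ffunE; case: (w i).
Qed.

Lemma sum_nfix n T :
  (\sum_(s : 'S_n) nfix T s <= n.+1 ^ #|T| * #|[set: 'S_n]|)%N.
Proof.
rewrite (leq_trans _ (leq_mul (card_word_orbits n T) (leqnn _))) //.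
rewrite -Frobenius_Cauchy; last by apply/actsP => s _ w; rewrite !inE.
apply: eq_leq; apply: eq_big => [s | s _]; first by rewrite inE.
by rewrite /nfix setTI.
Qed.

(** * The Young symmetrizer and its module *)

Section Specht.

Variables (F : fieldType) (n : nat) (lam : intpart n).
Hypothesis F0 : [pchar F] =i pred0.
Local Notation G := [set: 'S_n]%G.
Local Notation aG := (regular_repr F G).
Local Notation Y := (young_symmetrizer F lam).
Local Notation row i := (reshape_index (parts lam) i).
Local Notation col i := (reshape_offset (parts lam) i).
Local Notation e_ g := (delta_mx (0 : 'I_1) (gring_index G g) : 'rV[F]_(gcard G)).

Lemma sumn_parts : sumn (parts lam) = n.
Proof. by have /andP[_ /eqP] := valP lam. Qed.

Lemma row_stabP (s : 'S_n) :
  reflect (forall i, row (s i) = row i) (s \in row_stab lam).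
Proof. by rewrite inE; apply: (iffP forallP) => h i; apply/eqP. Qed.

Lemma col_stabP (s : 'S_n) :
  reflect (forall i, col (s i) = col i) (s \in col_stab lam).
Proof. by rewrite inE; apply: (iffP forallP) => h i; apply/eqP. Qed.

Lemma row_stabM (r p : 'S_n) :
  r \in row_stab lam -> ((r * p)%g \in row_stab lam) = (p \in row_stab lam).
Proof.
move=> /row_stabP Rr; apply/row_stabP/row_stabP => h i.
  by have := h (r^-1%g i); rewrite permM permKV => ->; rewrite -Rr permKV.
by rewrite permM h Rr.
Qed.

(** Here [q] is the inverse of [p], so it preserves rows as well as columns, and a cell is
    determined by its row and column. *)
Lemma row_col_stab (p q : 'S_n) :
  p \in row_stab lam -> q \in col_stab lam -> (p * q)%g = 1%g -> q = 1%g.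
Proof.
move=> /row_stabP Rp /col_stabP Cq /eqP; rewrite -eq_invg_mul => /eqP def_q.
apply/permP => i; rewrite perm1.
have Rq : row (q i) = row i by rewrite -[in RHS](permKV p i) Rp def_q.
by apply: val_inj; rewrite -[LHS](reshape_indexK (parts lam)) Rq Cq reshape_indexK.
Qed.

(** Its coefficient at the identity is 1: only [p = q = 1] contributes. *)
Lemma young_symmetrizer_neq0 : Y != 0.
Proof.
have R1 : 1%g \in row_stab lam by apply/row_stabP => i; rewrite perm1.
have C1 : 1%g \in col_stab lam by apply/col_stabP => i; rewrite perm1.
have coef (p q : 'S_n) : (p * q)%g != 1%g ->
    ((-1) ^+ q *: e_ (p * q)) 0 (gring_index G 1) = 0 :> F.
  move=> pq1; rewrite !mxE eqxx /= (can_in_eq (@gring_indexK _ G)) ?inE //.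
  by rewrite eq_sym (negPf pq1) mulr0.
apply: contraTneq (oner_neq0 F) => /matrixP/(_ 0 (gring_index G 1)).
rewrite mxE summxE (bigD1 1%g) //= summxE (bigD1 1%g) //= => <-.
rewrite odd_perm1 mulg1 !mxE !eqxx mulr1 !big1 ?addr0 ?eqxx // => [p|q].
  case/andP=> Rp p1; rewrite summxE big1 // => q Cq; apply: coef.
  apply: contraNneq p1 => pq1; rewrite -pq1.
  by rewrite (row_col_stab Rp Cq pq1) mulg1.
by case/andP=> Cq q1; apply: coef; rewrite mul1g.
Qed.

Lemma specht_dim_gt0 : (0 < \rank (cyclic_mx aG Y))%N.
Proof. by rewrite lt0n mxrank_eq0 cyclic_mx_eq0 young_symmetrizer_neq0. Qed.

Lemma in_strip_row k (i : 'I_n) : in_strip k lam -> (row i < k)%N.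
Proof.
move=> /eqP lamk; have /andP[lam_sorted _] := valP lam.
have i_lt : (i < sumn (parts lam))%N by rewrite sumn_parts.
rewrite ltnNge; apply/negP => le_k.
have lt_row := reshape_indexP i_lt.
have geq_trans : transitive geq by move=> a b c /= ? /leq_trans->.
have := sorted_leq_nth geq_trans leqnn 0%N lam_sorted.
move=> /(_ k _ (leq_ltn_trans le_k lt_row) lt_row le_k) /=.
(* The row of [i] would have length at most [nth 0 (parts lam) k = 0], yet it contains the column of
   [i]. *)
by rewrite lamk leqNgt (leq_ltn_trans _ (reshape_offsetP i_lt)).
Qed.

(** * Embedding the Specht module into the words *)

Section Embedding.

Variable k : nat.
Hypothesis lamk : in_strip k lam.

Definition row_word (g : 'S_n) : {ffun 'I_n -> 'I_k} :=
  [ffun i => Ordinal (in_strip_row (g^-1%g i) lamk)].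

Lemma row_word_act g s : row_word (g * s)%g = word_action n _ (row_word g) s.
Proof.
by apply/ffunP => i; rewrite !ffunE; apply: val_inj; rewrite /= invMg permM.
Qed.

(** The fibres of [row_word] are the right cosets of the row stabilizer. *)
Lemma row_word_eq g h : (row_word h == row_word g) = ((h * g^-1)%g \in row_stab lam).
Proof.
apply/eqP/row_stabP => [/ffunP eqw i | Rhg].
  have /(congr1 val) := eqw (h i); rewrite !ffunE /= permK => ->.
  by rewrite permM.
apply/ffunP => i; rewrite !ffunE; apply: val_inj => /=.
by have := Rhg (h^-1%g i); rewrite permM permKV.
Qed.

Definition to_words : 'M[F]_(gcard G, #|{ffun 'I_n -> 'I_k}|) :=
  \matrix_i delta_mx 0 (enum_rank (row_word (enum_val i))).

(** The transpose of [to_words]: a word goes to the sum of its fibre. *)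
Definition of_words : 'M[F]_(#|{ffun 'I_n -> 'I_k}|, gcard G) :=
  \matrix_j \sum_(g | row_word g == enum_val j) e_ g.

Local Notation P := (action_repr F G (word_action n 'I_k)).

Lemma to_words_hom s : aG s *m to_words = to_words *m P s.
Proof.
apply/row_matrixP => i; rewrite !row_mul !rowK -!rowE !rowK.
by rewrite gring_indexK ?inE // enum_rankK row_word_act.
Qed.

Lemma of_words_hom s : P s *m of_words = of_words *m aG s.
Proof.
apply/row_matrixP => j; rewrite !row_mul !rowK -!rowE !rowK enum_rankK mulmx_suml.
rewrite (reindex_inj (mulIg s)) /=; apply: eq_big => [g | g _].
  by rewrite row_word_act (inj_eq (act_inj _ s)).
by rewrite -rowE rowK gring_indexK ?inE.
Qed.

Lemma to_of_words g :
  e_ g *m (to_words *m of_words) = \sum_(r in row_stab lam) e_ (r * g)%g.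
Proof.
rewrite mulmxA -rowE rowK -rowE rowK enum_rankK gring_indexK ?inE //.
rewrite (reindex_inj (mulIg g)) /=; apply: eq_bigl => r.
by rewrite row_word_eq mulgK.
Qed.

(** Left multiplication by a row permutation only permutes the summands [p], so each such
    permutation contributes one copy of [Y]. *)
Lemma young_symmetrizer_eigen :
  Y *m (to_words *m of_words) = #|row_stab lam|%:R *: Y.
Proof.
transitivity (\sum_(r in row_stab lam) Y); last first.
  by rewrite sumr_const scaler_nat.
rewrite mulmx_suml.
under eq_bigr => p _ do rewrite mulmx_suml.
under eq_bigr => p _ do under eq_bigr => q _ do
  rewrite -scalemxAl to_of_words scaler_sumr.
under eq_bigr => p _ do rewrite exchange_big /=.
rewrite exchange_big /=; apply: eq_bigr => r Rr.
rewrite [RHS](reindex_inj (mulgI r)) /=; apply: eq_big => [p | p _].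
  by rewrite row_stabM.
by apply: eq_bigr => q _; rewrite mulgA.
Qed.

(** The composite commutes with the regular representation, so its eigenspace is a submodule; it
    contains the generator [Y]. *)
Lemma specht_eigen :
  (cyclic_mx aG Y <= kermx (to_words *m of_words - #|row_stab lam|%:R%:M))%MS.
Proof.
apply: cyclic_mx_sub.
  apply: kermx_centg_module; apply/centgmxP => s _.
  rewrite mulmxBr mulmxBl scalar_mxC; congr (_ - _).
  by rewrite mulmxA to_words_hom -!mulmxA of_words_hom.
by apply/sub_kermxP; rewrite mulmxBr young_symmetrizer_eigen mul_mx_scalar subrr.
Qed.

(* [to_words *m of_words], which sums over the row stabilizer, acts on the Specht
   module as a nonzero scalar, so [to_words] is injective there. *)
Lemma word_char_split : exists2 d, is_char (F := F) G d &
  forall s : 'S_n, (nfix 'I_k s)%:R = chi F lam s + d s.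
Proof.
have R_gt0 : #|row_stab lam|%:R != 0 :> F.
  have /pcharf0P-> := F0; rewrite -lt0n; apply/card_gt0P; exists 1%g.
  by apply/row_stabP => i; rewrite perm1.
pose B := val_submod (U := cyclic_mx aG Y) 1%:M.
have BK : B *m to_words *m of_words = #|row_stab lam|%:R *: B.
  apply/eqP; rewrite -subr_eq0 -mulmxA -mul_mx_scalar -mulmxBr; apply/eqP/sub_kermxP.
  by rewrite val_submod1 specht_eigen.
have [|s _|d dchar def_d] :=
  @mxtrace_intertwine _ _ G _ _ (specht_repr F lam) P (B *m to_words).
(* Following [B *m to_words] by [of_words] gives a nonzero multiple of [B], so no rank is lost. *)
- rewrite /row_free eqn_leq rank_leq_row /=.
  apply: leq_trans (mxrankM_maxl _ of_words).
  by rewrite BK mxrank_scale_nz // val_submod1.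
- rewrite -[RHS]mulmxA -to_words_hom [LHS]mulmxA [RHS]mulmxA; congr (_ *m _).
  by rewrite /B -val_submodE -[specht_repr _ _ _]mul1mx val_submodJ ?inE.
by exists d => // s; rewrite -def_d ?inE // mxtrace_action.
Qed.

End Embedding.

End Specht.

(** * Bounding the norm of a product of two characters *)

Section KroneckerBound.

Variables (F : fieldType) (n k : nat).
Hypothesis F0 : [pchar F] =i pred0.
Variable kappa : intpart n -> intpart n -> intpart n -> nat.
Hypothesis kappaP : kronecker_multiplicities F kappa.
Local Notation G := [set: 'S_n]%G.

Lemma chi_is_char (lam : intpart n) : is_char (F := F) G (chi F lam).
Proof. by eexists _, (specht_repr F lam). Qed.

Lemma kronecker_sq_le (lam mu rho : intpart n)
    (f := fun s => chi F lam s * chi F mu s) : exists2 m : nat,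
  cdot G f f = m%:R
  & (kappa lam mu rho ^ 2 <= m)%N.
Proof.
have eqk : {in G, f =1 fun s => \sum_r (kappa lam mu r)%:R * chi F r s}.
  by move=> s _; apply: kappaP.
have /fin_all_exists[c cP] r : exists c : {ffun intpart n -> nat},
    forall r', cdot G (chi F r) (chi F r') = (c r')%:R.
  have /fin_all_exists[c cP] r' := cdot_nat F0 (chi_is_char r) (chi_is_char r').
  by exists (finfun c) => r'; rewrite ffunE.
exists (\sum_r \sum_r' kappa lam mu r * (kappa lam mu r' * c r r'))%N.
  rewrite (eq_cdot eqk eqk) cdot_suml natr_sum; apply: eq_bigr => r _.
  rewrite cdot_sumr mulr_sumr natr_sum; apply: eq_bigr => r' _.
  by rewrite cP !natrM.
(* All terms are natural numbers; keep only the one at ([rho], [rho]). *)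
rewrite (bigD1 rho) //= (bigD1 rho) //= -addnA; apply: leq_trans (leq_addr _ _).
rewrite mulnA leq_pmulr //.
have [m def_m m_gt0] := cdot_norm_gt0 F0 (specht_dim_gt0 F rho)
  (f := chi F rho) (rG := specht_repr F rho) (fun s _ => erefl).
by move: def_m; rewrite cP => /(pchar0_natr_inj F0)->.
Qed.

Lemma cdot_chi_words (lam mu : intpart n)
    (f := fun s => chi F lam s * chi F mu s) :
    in_strip k lam -> in_strip k mu ->
  exists2 m : nat, cdot G f f = m%:R
  & (m <= n.+1 ^ (k * k * (k * k)))%N.
Proof.
move=> lamk muk.
have [d dchar def_d] := word_char_split F0 lamk.
have [e echar def_e] := word_char_split F0 muk.
(* The rest of the product [(chi F lam s + d s) * (chi F mu s + e s)] once [f s] is removed. *)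
pose h (s : 'S_n) := chi F lam s * e s + d s * (chi F mu s + e s).
have fchar : is_char G f by apply: is_charM; apply: chi_is_char.
have hchar : is_char G h.
  by do ![apply: is_charM | apply: is_charD | apply: chi_is_char | by []].
pose p (s : 'S_n) : F := (nfix ('I_k * 'I_k)%type s)%:R.
have def_p : {in G, p =1 fun s => f s + h s}.
  move=> s _; rewrite /p -nfixM natrM {1}def_d def_e /f /h.
  by rewrite mulrDl mulrDr addrA.
have [m1 E1] := cdot_nat F0 fchar fchar.
have [m2 E2] := cdot_nat F0 fchar hchar.
have [m3 E3] := cdot_nat F0 hchar fchar.
have [m4 E4] := cdot_nat F0 hchar hchar.
exists m1 => //; clearbody f h.
have: cdot G p p = (m1 + m2 + (m3 + m4))%:R.
  by rewrite (eq_cdot def_p def_p) cdotDl !cdotDr E1 E2 E3 E4 !natrD.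
(* The summand becomes the number of fixed words over [k ^ 4] letters, ready for Burnside. *)
rewrite /cdot; under eq_bigr => s _ do rewrite /p nfixV -natrM nfixM.
have := sum_nfix n (('I_k * 'I_k) * ('I_k * 'I_k))%type.
rewrite !card_prod card_ord -natr_sum.
rewrite (eq_bigl (fun=> true)); last by move=> s; rewrite inE.
move=> le_sum /(canRL (mulVKf _)); have /pcharf0P-> := F0.
rewrite -lt0n cardG_gt0 -natrM => /(_ isT)/(pchar0_natr_inj F0) def_sum.
move: le_sum; rewrite {}def_sum mulnC leq_pmul2r ?cardG_gt0 //.
by apply: leq_trans; rewrite -!addnA leq_addr.
Qed.

End KroneckerBound.

Theorem theorem1p2 (R : realType) (k : nat) (hk : (0 < k)%N) :
  exists a b : R,
    forall (F : fieldType) (hF : [pchar F] =i pred0) (n : nat) (hn : (0 < n)%N)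
           (kappa : intpart n -> intpart n -> intpart n -> nat)
           (hkappa : kronecker_multiplicities F kappa)
           (lam mu rho : intpart n),
      in_strip k lam -> in_strip k mu ->
      (kappa lam mu rho)%:R <= a * n%:R `^ b.
Proof.
(* For [n] positive, [n.+1 ^ e <= (2 * n) ^ e], whence the factor [2 ^+ e]. *)
pose e := (k * k * (k * k))%N; exists (2 ^+ e), e%:R.
move=> F hF n hn kappa hkappa lam mu rho lamk muk.
rewrite powR_mulrn // -exprMn -natrM -natrX ler_nat.
have [m1 def1 le1] := kronecker_sq_le hF hkappa lam mu rho.
have [m2 def2 le2] := cdot_chi_words hF lamk muk.
have eqm : m1 = m2 by apply: (pchar0_natr_inj hF); rewrite -def1 -def2.
apply: leq_trans (leq_trans le2 _); last first.
  by rewrite leq_exp2r ?muln_gt0 ?hk // mul2n -addnn -addn1 leq_add2l.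
(* A natural number is at most its square. *)
rewrite -eqm; apply: leq_trans le1.
by case: (kappa _ _ _) => // x; rewrite -mulnn leq_pmulr.
Qed.
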